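(* Let $S\ge1$ and $k\ge1$ be integers and let $R=3S$. Then the series $$(-1)^k\,\frac{\sum_{j=k}^\infty(-1)^jq^{Rj(j+1)/2}\left(q^{-Sj}-q^{(j+1)S}\right)}{(q^S,q^{R-S};q^R)_\infty},$$ expanded as a power series in $q$, has nonnegative coefficients.
   Context: $(a;p)_\infty=\prod_{m\ge0}(1-ap^m)$ and $(a,b;p)_\infty=(a;p)_\infty(b;p)_\infty$. *)

(* Defs.v *)
From HB Require Import structures.
From mathcomp Require Import all_boot all_order all_algebra.
From mathcomp Require Import boolp classical_sets.
From mathcomp Require Import zify.
Set Implicit Arguments.
Unset Strict Implicit.
Unset Printing Implicit Defensive.
Import Order.TTheory GRing.Theory Num.Theory.
Local Open Scope ring_scope.

(* Formal power series are a record, not the bare function type nat -> K,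
   because MathComp equips functions with the pointwise ring structure. *)
Record fps (K : Type) := Fps { fpscoef : nat -> K }.

Lemma fps_ext (K : Type) (f g : fps K) :
  (forall n, fpscoef f n = fpscoef g n) -> f = g.
Proof. by case: f g => [f] [g] /= /funext ->. Qed.

HB.instance Definition _ (K : Type) := gen_eqMixin (fps K).
HB.instance Definition _ (K : Type) := gen_choiceMixin (fps K).

Section FpsRing.
Variable K : comNzRingType.
Implicit Types f g h : fps K.

Definition fps_zero : fps K := Fps (fun=> 0).
Definition fps_opp f : fps K := Fps (fun n => - fpscoef f n).
Definition fps_add f g : fps K := Fps (fun n => fpscoef f n + fpscoef g n).
Definition fps_one : fps K := Fps (fun n => (n == 0%N)%:R).
Definition fps_mul f g : fps K :=
  Fps (fun n => \sum_(i < n.+1) fpscoef f i * fpscoef g (n - i)).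

Fact fps_addA : associative fps_add.
Proof. by move=> f g h; apply: fps_ext => n /=; rewrite addrA. Qed.
Fact fps_addC : commutative fps_add.
Proof. by move=> f g; apply: fps_ext => n /=; rewrite addrC. Qed.
Fact fps_add0 : left_id fps_zero fps_add.
Proof. by move=> f; apply: fps_ext => n /=; rewrite add0r. Qed.
Fact fps_addN : left_inverse fps_zero fps_opp fps_add.
Proof. by move=> f; apply: fps_ext => n /=; rewrite addNr. Qed.

HB.instance Definition _ :=
  GRing.isZmodule.Build (fps K) fps_addA fps_addC fps_add0 fps_addN.

Definition fps_trunc (N : nat) f : {poly K} := \poly_(i < N) fpscoef f i.

Lemma coef_fps_trunc_mul N f g n : (n < N)%N ->
  fpscoef (fps_mul f g) n = (fps_trunc N f * fps_trunc N g)`_n.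
Proof.
move=> ltnN; rewrite coefM /=; apply: eq_bigr => i _.
by rewrite !coef_poly !ifT //; have := ltn_ord i; lia.
Qed.

Lemma coefM_eq (p p' r r' : {poly K}) n :
  (forall i, (i <= n)%N -> p`_i = p'`_i) ->
  (forall i, (i <= n)%N -> r`_i = r'`_i) -> (p * r)`_n = (p' * r')`_n.
Proof.
move=> pp' rr'; rewrite !coefM; apply: eq_bigr => i _.
by rewrite pp' ?rr' //; have := ltn_ord i; lia.
Qed.

Lemma fps_trunc_mul N f g n : (n < N)%N ->
  (fps_trunc N (fps_mul f g))`_n = (fps_trunc N f * fps_trunc N g)`_n.
Proof. by move=> ltnN; rewrite coef_poly ltnN (coef_fps_trunc_mul _ _ ltnN). Qed.

Fact fps_mulA : associative fps_mul.
Proof.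
move=> f g h; apply: fps_ext => n.
rewrite !(@coef_fps_trunc_mul n.+1) //.
transitivity ((fps_trunc n.+1 f * (fps_trunc n.+1 g * fps_trunc n.+1 h))`_n).
  by apply: coefM_eq => // i lein; rewrite fps_trunc_mul.
by rewrite mulrA; apply: coefM_eq => // i lein; rewrite fps_trunc_mul.
Qed.

Fact fps_mulC : commutative fps_mul.
Proof.
move=> f g; apply: fps_ext => n.
by rewrite !(@coef_fps_trunc_mul n.+1) // mulrC.
Qed.

Fact fps_mul1 : left_id fps_one fps_mul.
Proof.
move=> f; apply: fps_ext => n /=; rewrite big_ord_recl mul1r subn0.
by rewrite big1 ?addr0 // => i _; rewrite mul0r.
Qed.

Fact fps_mulDl : left_distributive fps_mul fps_add.
Proof.
move=> f g h; apply: fps_ext => n /=.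
by rewrite -big_split; apply: eq_bigr => i _; rewrite mulrDl.
Qed.

Fact fps_one_neq0 : fps_one != 0.
Proof.
by apply/eqP => /(congr1 (fun f => fpscoef f 0%N)) /eqP; rewrite oner_eq0.
Qed.

HB.instance Definition _ := GRing.Zmodule_isComNzRing.Build (fps K)
  fps_mulA fps_mulC fps_mul1 fps_mulDl fps_one_neq0.

(* f^-1 is the inverse power series when f has one, and f itself otherwise
   (MathComp's convention); fps_unit_coef0 below gives a criterion. *)
Definition fps_unit : {pred fps K} := fun f => `[< exists g, g * f = 1 >].
Definition fps_inv f : fps K := xget f [set g | g * f = 1]%classic.

Fact fps_mulV : {in fps_unit, left_inverse 1 fps_inv *%R}.
Proof.
move=> f /asboolP fU.
exact: (xgetPex (P := [set g | g * f = 1]%classic) f fU).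
Qed.
Fact fps_unitP f g : g * f = 1 -> fps_unit f.
Proof. by move=> gf1; apply/asboolP; exists g. Qed.
Fact fps_inv_out : {in [predC fps_unit], fps_inv =1 id}.
Proof.
move=> f /negP fU; apply: xgetPN => g gf1.
by apply: fU; apply: fps_unitP gf1.
Qed.

HB.instance Definition _ := GRing.ComNzRing_hasMulInverse.Build (fps K)
  fps_mulV fps_unitP fps_inv_out.

Definition fpsX : fps K := Fps (fun n => (n == 1)%:R).

(* Coefficientwise convergence: each coefficient is eventually constant. *)
Definition fps_cvg (u : nat -> fps K) f : Prop :=
  forall n, exists N, forall M, (N <= M)%N -> fpscoef (u M) n = fpscoef f n.

(* Default value 0 if u does not converge. *)
Definition fps_lim (u : nat -> fps K) : fps K :=
  xget 0 [set f | fps_cvg u f]%classic.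

Definition fps_series (k : nat) (u : nat -> fps K) : fps K :=
  fps_lim (fun N => \sum_(k <= j < N) u j).

(* (a; p)_oo *)
Definition qpoch (a p : fps K) : fps K :=
  fps_lim (fun N => \prod_(m < N) (1 - a * p ^+ m)).

(* (a, b; p)_oo *)
Definition qpoch2 (a b p : fps K) : fps K := qpoch a p * qpoch b p.

Lemma fps_lim_eq u f : fps_cvg u f -> fps_lim u = f.
Proof.
move=> uf; apply: xget_unique => // g ug; apply: fps_ext => n.
have [N1 /(_ (maxn N1 _)) h1] := uf n; have [N2 h2] := ug n.
by rewrite -(h1 N2) ?leq_maxl // h2 // leq_maxr.
Qed.

Lemma fps_lim_coef u n N :
  (forall n, exists N, forall M, (N <= M)%N ->
     fpscoef (u M.+1) n = fpscoef (u M) n) ->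
  (forall M, (N <= M)%N -> fpscoef (u M.+1) n = fpscoef (u M) n) ->
  fps_cvg u (fps_lim u) /\ fpscoef (fps_lim u) n = fpscoef (u N) n.
Proof.
have cst m N0 : (forall M, (N0 <= M)%N -> fpscoef (u M.+1) m = fpscoef (u M) m) ->
    forall M, (N0 <= M)%N -> fpscoef (u M) m = fpscoef (u N0) m.
  move=> h M; elim: M => [|M IH]; first by rewrite leqn0 => /eqP <-.
  by rewrite leq_eqVlt => /predU1P[<- //|]; rewrite ltnS => le; rewrite h ?IH.
move=> /choice[B uB] uN.
have uf : fps_cvg u (Fps (fun m => fpscoef (u (B m)) m)).
  by move=> m; exists (B m) => M le /=; apply: cst le; apply: uB.
rewrite (fps_lim_eq uf); split=> //=.
rewrite -(cst _ _ (uB n) (maxn (B n) N)) ?leq_maxl //.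
by rewrite (cst _ _ uN) ?leq_maxr.
Qed.

Local Arguments fpscoef : simpl never.

Lemma fpscoefD f g n : fpscoef (f + g) n = fpscoef f n + fpscoef g n.
Proof. by []. Qed.

Lemma fpscoefN f n : fpscoef (- f) n = - fpscoef f n.
Proof. by []. Qed.

Lemma fpscoefM f g n :
  fpscoef (f * g) n = \sum_(i < n.+1) fpscoef f i * fpscoef g (n - i).
Proof. by []. Qed.

Lemma fpscoef_Xn i n : fpscoef (fpsX ^+ i) n = (n == i)%:R.
Proof.
elim: i n => [|i IH] n //; rewrite exprS fpscoefM.
case: n => [|n]; first by rewrite big_ord1 mul0r.
rewrite !big_ord_recl mul0r add0r mul1r big1 => [|j _]; last by rewrite mul0r.
by rewrite addr0 IH /bump /= subSS subn0 eqSS.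
Qed.

Lemma fpscoef_mulXn f i n : (n < i)%N -> fpscoef (f * fpsX ^+ i) n = 0.
Proof.
move=> lt; rewrite fpscoefM big1 // => j _; rewrite fpscoef_Xn.
by rewrite [_ == _](_ : _ = false) ?mulr0 //; lia.
Qed.

Lemma fpsX_qpoch_cvg a p : (0 < p)%N ->
  fps_cvg (fun N => \prod_(m < N) (1 - fpsX ^+ a * (fpsX ^+ p) ^+ m))
    (qpoch (fpsX ^+ a) (fpsX ^+ p)).
Proof.
move=> p0.
have st n M : (n.+1 <= M)%N ->
    fpscoef (\prod_(m < M.+1) (1 - fpsX ^+ a * (fpsX ^+ p) ^+ m)) n
      = fpscoef (\prod_(m < M) (1 - fpsX ^+ a * (fpsX ^+ p) ^+ m)) n.
  move=> leM; rewrite big_ord_recr [X in fpscoef X _ = _]/= mulrBr mulr1 -exprM -exprD.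
  by rewrite fpscoefD fpscoefN fpscoef_mulXn ?subr0 //; nia.
by case: (@fps_lim_coef (fun N => \prod_(m < N) (1 - fpsX ^+ a * (fpsX ^+ p) ^+ m)) 0 1)
  => // [n|M]; [exists n.+1 => M; apply: st | apply: st].
Qed.

Lemma fpsX_qpoch_coef0 a p : (0 < a)%N -> (0 < p)%N ->
  fpscoef (qpoch (fpsX ^+ a) (fpsX ^+ p)) 0 = 1.
Proof.
move=> a0 p0; have [N /(_ N (leqnn N)) <-] := fpsX_qpoch_cvg a p0 0.
elim: N => [|N IH]; first by rewrite big_ord0.
rewrite big_ord_recr fpscoefM big_ord1 IH mul1r -exprM -exprD.
rewrite fpscoefD fpscoefN fpscoef_Xn [_ == _](_ : _ = false); last by lia.
by rewrite /= subr0.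
Qed.

End FpsRing.

Lemma fps_unit_coef0 (K : comUnitRingType) (f : fps K) :
  fpscoef f 0 \is a GRing.unit -> f \is a GRing.unit.
Proof.
move=> f0.
pose nx (s : seq K) : seq K := rcons s ((fpscoef f 0)^-1 *
  (((size s == 0)%N)%:R - \sum_(i < size s) s`_i * fpscoef f (size s - i))).
pose s n := iter n nx [::].
have ss n : size (s n) = n by elim: n => // n IH; rewrite /= size_rcons IH.
have sn m n i : (i < n)%N -> (n <= m)%N -> (s m)`_i = (s n)`_i.
  move=> lt; elim: m => [|m IH]; first by rewrite leqn0 => /eqP e; rewrite e in lt.
  rewrite leq_eqVlt => /predU1P[<- //|]; rewrite ltnS => le.
  by rewrite /= nth_rcons ss (leq_trans lt le) IH.
apply/asboolP; exists (Fps (fun n => (s n.+1)`_n)); apply: fps_ext => n.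
rewrite fpscoefM big_ord_recr /= subnn nth_rcons ss ltnn eqxx mulrAC mulVr //.
rewrite mul1r addrCA -[RHS]addr0; congr (_ + _).
apply/eqP; rewrite subr_eq0; apply/eqP; apply: eq_bigr => i _.
by congr (_ * _); rewrite -(sn n i.+1 i).
Qed.

Local Notation q := (fpsX int).

(* The half is exact because j (j + 1) is even.  The product
   q ^ (R j (j + 1) / 2) q ^ (- S j) is written with a single exponent, where
   the natural-number subtraction does not truncate as soon as S <= R
   (theta_term_exponent). *)
Definition theta_term (R S j : nat) : fps int :=
  (-1) ^+ j * (q ^+ ((R * (j * j.+1))./2 - S * j)
               - q ^+ ((R * (j * j.+1))./2 + j.+1 * S)).

Lemma theta_term_exponent R S j : (S <= R)%N -> (S * j <= (R * (j * j.+1))./2)%N.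
Proof.
move=> leSR; suff : ((S * j).*2 <= R * (j * j.+1))%N by lia.
case: j => [|j]; first by rewrite muln0.
by rewrite -muln2 -mulnA leq_mul //; nia.
Qed.

Lemma denominator_unit R S : (0 < S < R)%N ->
  qpoch2 (q ^+ S) (q ^+ (R - S)) (q ^+ R) \is a GRing.unit.
Proof.
move=> /andP[S0 SR]; apply: fps_unit_coef0.
by rewrite fpscoefM big_ord1 !fpsX_qpoch_coef0 ?mulr1 //; lia.
Qed.

Lemma numerator_cvg R S k : (0 < S < R)%N ->
  fps_cvg (fun N => \sum_(k <= j < N) theta_term R S j) (fps_series k (theta_term R S)).
Proof.
move=> /andP[S0 SR].
have ex j n : (n < j)%N -> fpscoef (theta_term R S j) n = 0.
  move=> lt; have : ((S * j).*2 + (j * j.+1) <= R * (j * j.+1))%N.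
    by rewrite -muln2 -mulnA; nia.
  have : (j.*2 <= j * j.+1)%N by nia.
  move=> h1 h2; rewrite /theta_term mulrBr fpscoefD fpscoefN.
  by rewrite !fpscoef_mulXn ?subr0 //; lia.
have st n M : (maxn k n.+1 <= M)%N ->
    fpscoef (\sum_(k <= j < M.+1) theta_term R S j) n
      = fpscoef (\sum_(k <= j < M) theta_term R S j) n.
  rewrite geq_max => /andP[kM nM].
  by rewrite big_nat_recr // [LHS]fpscoefD ex ?addr0.
by case: (@fps_lim_coef _ (fun N => \sum_(k <= j < N) theta_term R S j) 0
  (maxn k 1)) => // [n|M]; [exists (maxn k n.+1) => M; apply: st | apply: st].
Qed.

(* Main.v *)
Require Import Defs.
From mathcomp Require Import all_boot all_order all_algebra.
From mathcomp Require Import zify ring.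
Import GRing.Theory Num.Theory.
Local Open Scope ring_scope.

(** Put x = q^S.  Then the denominator is D = (x, x^2; x^3)_oo, the product of
    the 1 - x^m over the m not divisible by 3, and the numerator is the tail
    of a pentagonal number series: with p_j = j (3 j + 1) / 2 its terms are
    (-1)^j t_j, where t_j = x^(p_j) (1 - x^(2 j + 1)).

    Pairing consecutive terms is natural, but (t_j - t_(j+1)) / D has negative
    coefficients: as x tends to 1, the tail sum_(i >= 0) (-1)^i t_(k+i) behaves
    like k (1 - x), and its pairs like - 2 (1 - x).  This is repaired by
    b_j = x^(p_j) (1 - x^(j - 1)), which behaves like (j - 1) (1 - x), so that
    b_j - b_(j+2) absorbs the - 2 (1 - x).  The identity theta_pent_pair reads

      t_j - t_(j+1) = b_j - b_(j+2) + x^(p_j + j - 1) E_(j+1),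
      E_J = (1 - x) (1 - x^(2J+1)) + x (1 - x^J) (1 - x^(2J+1)) (1 - x^(3J+1)).

    Summed over the pairs j = k, k + 2, ... the b_j telescope, so the tail is
    b_k plus a sum of monomials times E_J with J >= k + 1 >= 2.

    Each piece is now nonnegative after division by D, by cancelling distinct
    factors of D.  For b_k, 1 - x divides 1 - x^(k - 1).  For the second part
    of E_J, 3J + 1 is prime to 3, and so is one of J and 2J + 1; the remaining
    factor is a multiple of 1 - x with nonnegative quotient.  The first part of
    E_J consists of two factors of D unless 3 divides 2J + 1, and in that case
    1 - x^(2J+1) = (1 - x^(2J-4)) + x^(2J-4) (1 - x^5)
    reduces it to the factors 1 - x^2 and 1 - x^5 of D.  This is the content
    of pair_excess_ge0, where fps_ge0_cancel does the cancelling.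

    A given coefficient only sees finitely many terms of the numerator and
    finitely many factors of D, so everything is done for finite sums and
    products. *)


Set Implicit Arguments.
Unset Strict Implicit.
Unset Printing Implicit Defensive.

(** * Series with nonnegative coefficients *)

Definition fps_ge0 (f : fps int) : Prop := forall n, 0 <= fpscoef f n.

Lemma fps_ge0D f g : fps_ge0 f -> fps_ge0 g -> fps_ge0 (f + g).
Proof. by move=> f0 g0 n; rewrite fpscoefD addr_ge0. Qed.

Lemma fps_ge0M f g : fps_ge0 f -> fps_ge0 g -> fps_ge0 (f * g).
Proof. by move=> f0 g0 n; rewrite fpscoefM sumr_ge0 // => i _; rewrite mulr_ge0. Qed.

Lemma fps_ge0_Xn d : fps_ge0 (fpsX int ^+ d).
Proof. by move=> n; rewrite fpscoef_Xn ler0n. Qed.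

Lemma fps_ge0_1 : fps_ge0 1.
Proof. by rewrite -(expr0 (fpsX int)); apply: fps_ge0_Xn. Qed.

Lemma fps_ge0_sum (I : Type) (r : seq I) (P : pred I) (F : I -> fps int) :
  (forall i, P i -> fps_ge0 (F i)) -> fps_ge0 (\sum_(i <- r | P i) F i).
Proof.
by move=> F0; apply: big_ind => //; exact: fps_ge0D.
Qed.

Lemma fps_ge0_prod (I : Type) (r : seq I) (P : pred I) (F : I -> fps int) :
  (forall i, P i -> fps_ge0 (F i)) -> fps_ge0 (\prod_(i <- r | P i) F i).
Proof. by move=> F0; apply: big_ind => //; exact: fps_ge0M. Qed.

Lemma fps_one_subX_unit d : (0 < d)%N -> 1 - fpsX int ^+ d \is a GRing.unit.
Proof.
move=> d0; apply: fps_unit_coef0.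
by rewrite fpscoefD fpscoefN fpscoef_Xn; case: d d0.
Qed.

(** The inverse g satisfies g = 1 + q^d g, which expresses each coefficient of g
    by coefficients of lower index. *)
Lemma fps_ge0_geometric d : (0 < d)%N -> fps_ge0 (1 - fpsX int ^+ d)^-1.
Proof.
move=> d0; have := mulrV (fps_one_subX_unit d0); set g := _^-1.
rewrite mulrBl mul1r => /(canRL (subrK _)) gE.
elim/ltn_ind => n IH; rewrite gE fpscoefD addr_ge0 ?fps_ge0_1 //.
rewrite fpscoefM sumr_ge0 // => -[[|i] ilt] _ /=; rewrite fpscoef_Xn.
  by rewrite (ltn_eqF d0) mul0r.
by rewrite mulr_ge0 ?ler0n // IH //; lia.
Qed.

(** * Agreement of series up to a given order *)

Definition fps_eq_upto n (f g : fps int) :=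
  forall m, (m <= n)%N -> fpscoef f m = fpscoef g m.

Lemma fps_eq_uptoM n f f' g g' : fps_eq_upto n f f' -> fps_eq_upto n g g' ->
  fps_eq_upto n (f * g) (f' * g').
Proof.
move=> ff gg m lemn; rewrite !fpscoefM; apply: eq_bigr => i _.
by rewrite ff ?gg //; have := ltn_ord i; lia.
Qed.

(** Both inverses are multiples of the common series f^-1 g^-1, by g and by f. *)
Lemma fps_eq_uptoV n f g : f \is a GRing.unit -> g \is a GRing.unit ->
  fps_eq_upto n f g -> fps_eq_upto n f^-1 g^-1.
Proof.
move=> fU gU fg m lemn.
have -> : f^-1 = f^-1 * g^-1 * g by rewrite mulrVK.
have {2}-> : g^-1 = f^-1 * g^-1 * f by rewrite mulrAC mulVr // mul1r.
by symmetry; apply: fps_eq_uptoM lemn.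
Qed.

Lemma fps_cvg_upto u f n : fps_cvg u f ->
  exists N, forall M, (N <= M)%N -> fps_eq_upto n (u M) f.
Proof.
move=> uf; elim: n => [|n [N IH]].
  have [N h] := uf 0%N; exists N => M le m; rewrite leqn0 => /eqP ->; exact: h.
have [N' h] := uf n.+1; exists (maxn N N') => M; rewrite geq_max => /andP[le le'] m.
by rewrite leq_eqVlt => /predU1P[->|]; [apply: h | apply: IH].
Qed.

(** * Pentagonal numbers *)

Definition pent j := ((j * (3 * j).+1)./2)%N.

Lemma pent_double j : ((pent j).*2 = j * (3 * j).+1)%N.
Proof. by rewrite even_halfK // oddM /= oddM; case: odd. Qed.

Lemma pentS j : pent j.+1 = (pent j + (3 * j + 2))%N.
Proof.
apply: double_inj; rewrite doubleD !pent_double; lia.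
Qed.

Lemma leq_pent j : (j <= pent j)%N.
Proof. by have := pent_double j; nia. Qed.

(** * Pairing the terms of the pentagonal series *)

Section PairIdentity.
Variable K : comNzRingType.
Implicit Type x : K.

Lemma one_subX_mul x d n :
  1 - x ^+ (d * n) = (\sum_(i < n) x ^+ (d * i)) * (1 - x ^+ d).
Proof.
rewrite -opprB exprM subrX1 mulrC -mulrN opprB; congr (_ * _).
by apply: eq_bigr => i _; rewrite exprM.
Qed.

(** A factor 1 - x^n not found in a product of distinct 1 - x^m can be traded
    for 1 - x. *)
Lemma one_subX_prod x n (s : seq nat) :
  (1 - x ^+ n) * \prod_(m <- s) (1 - x ^+ m)
  = (\sum_(i < n) x ^+ i) * \prod_(m <- 1%N :: s) (1 - x ^+ m).
Proof.
rewrite big_cons mulrA -{1}[n]mul1n one_subX_mul.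
by congr (_ * _ * _); apply: eq_bigr => i _; rewrite mul1n.
Qed.

Lemma one_subX_prod3 x n a b :
  (1 - x ^+ n) * (1 - x ^+ a) * (1 - x ^+ b)
  = (\sum_(i < n) x ^+ i) * \prod_(m <- [:: 1%N; a; b]) (1 - x ^+ m).
Proof. by rewrite -one_subX_prod !big_cons big_nil mulr1 mulrA. Qed.

(** This trades 1 - x^(d n + e) for 1 - x^d and 1 - x^e. *)
Lemma one_subX_split x d e n : (1 - x) * (1 - x ^+ (d * n + e)) =
  (\sum_(i < n) x ^+ (d * i)) * \prod_(m <- [:: 1%N; d]) (1 - x ^+ m)
  + x ^+ (d * n) * \prod_(m <- [:: 1%N; e]) (1 - x ^+ m).
Proof.
rewrite !big_cons !big_nil !mulr1 [in RHS]mulrCA -one_subX_mul exprD expr1.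
by ring.
Qed.

Definition pair_excess x J := (1 - x) * (1 - x ^+ (2 * J).+1)
  + x * ((1 - x ^+ J) * (1 - x ^+ (2 * J).+1) * (1 - x ^+ (3 * J).+1)).

Definition theta_pent x j := x ^+ pent j * (1 - x ^+ (2 * j).+1).

(** The exponent j.-1 makes boundary x j - boundary x j.+2 agree with the pair of
    terms up to a difference vanishing to second order at x = 1. *)
Definition boundary x j := x ^+ pent j * (1 - x ^+ j.-1).

Lemma theta_pent_pair x j : (0 < j)%N ->
  theta_pent x j - theta_pent x j.+1
  = boundary x j - boundary x j.+2 + x ^+ (pent j + j.-1) * pair_excess x j.+1.
Proof.
case: j => // i _; rewrite /theta_pent /boundary /pair_excess !pentS /=.
have -> : (2 * i.+1 = i * 2 + 2)%N by lia.
have -> : (2 * i.+2 = i * 2 + 4)%N by lia.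
have -> : (3 * i.+1 = i * 3 + 3)%N by lia.
have -> : (3 * i.+2 = i * 3 + 6)%N by lia.
have -> : (3 * i = i * 3)%N by lia.
rewrite !(exprS, exprD, exprM).
by move: (x ^+ pent i) (x ^+ i) => a t; ring.
Qed.

(** The boundary terms of consecutive pairs telescope. *)
Lemma theta_pent_sum x k N : (0 < k)%N ->
  \sum_(i < 2 * N) (-1) ^+ i * theta_pent x (k + i)
  = boundary x k - boundary x (k + 2 * N)
    + \sum_(i < N) x ^+ (pent (k + 2 * i) + (k + 2 * i).-1)
                   * pair_excess x (k + 2 * i).+1.
Proof.
move=> k0; elim: N => [|N IH].
  by rewrite muln0 addn0 !big_ord0 subrr addr0.
have -> : (2 * N.+1 = (2 * N).+2)%N by lia.
rewrite !big_ord_recr /= IH !addnS exprS exprM sqrrN !expr1n mulr1 mulN1r mul1r.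
have := theta_pent_pair x (ltn_addr (2 * N) k0).
by move=> /(canRL (subrK _)) ->; ring.
Qed.

End PairIdentity.

(** * Division by the product over the exponents prime to 3 *)

Section Cubic.
Variable S : nat.
Hypothesis S0 : (0 < S)%N.
Local Notation x := (fpsX int ^+ S).

Lemma theta_term_pent j :
  theta_term (3 * S) S j = (-1) ^+ j * theta_pent x j.
Proof.
rewrite /theta_term /theta_pent; congr (_ * _); rewrite mulrBr mulr1 -exprD -!exprM.
have eP := pent_double j.
have e2 : ((3 * S * (j * j.+1))./2 = S * (pent j + j))%N.
  apply: double_inj; rewrite even_halfK.
    by rewrite doubleMr doubleD eP; lia.
  by rewrite !oddM /= andbN andbF.
by rewrite e2; congr (_ ^+ _ - _ ^+ _); lia.
Qed.

Lemma fps_ge0_xn d : fps_ge0 (x ^+ d).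
Proof. by rewrite -exprM; apply: fps_ge0_Xn. Qed.

Definition denom M :=
  (\prod_(m < M) (1 - x * (x ^+ 3) ^+ m)) * \prod_(m < M) (1 - x ^+ 2 * (x ^+ 3) ^+ m).

Definition regular_parts M :=
  [seq (3 * i).+1 | i <- index_iota 0 M] ++ [seq (3 * i).+2 | i <- index_iota 0 M].

Lemma denomE M : denom M = \prod_(m <- regular_parts M) (1 - x ^+ m).
Proof.
rewrite /denom /regular_parts big_cat !big_map !big_mkord.
by congr (_ * _); apply: eq_bigr => i _; rewrite -[in RHS](add2n, add1n) exprD exprM.
Qed.

Lemma mem_regular_parts M m : (m < 3 * M)%N -> ~~ (3 %| m)%N -> m \in regular_parts M.
Proof.
move=> lt n3; rewrite mem_cat; apply/orP.
have [e|e] : ((m = 3 * (m %/ 3) + 1) \/ (m = 3 * (m %/ 3) + 2))%N by lia.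
  by left; apply/mapP; exists (m %/ 3)%N; [rewrite mem_index_iota|]; lia.
by right; apply/mapP; exists (m %/ 3)%N; [rewrite mem_index_iota|]; lia.
Qed.

Lemma regular_parts_gt0 M m : m \in regular_parts M -> (0 < m)%N.
Proof. by rewrite mem_cat => /orP[] /mapP[i _ ->]. Qed.

Lemma one_subx_unit d : (0 < d)%N -> 1 - x ^+ d \is a GRing.unit.
Proof. by move=> d0; rewrite -exprM fps_one_subX_unit ?muln_gt0 ?S0. Qed.

(** Once the factors indexed by s are cancelled, only inverses of factors
    1 - x^m are left; s must be duplicate-free because each factor occurs once
    in the denominator. *)
Lemma fps_ge0_cancel M (s : seq nat) g : fps_ge0 g -> uniq s ->
  all (fun m => (m < 3 * M)%N && ~~ (3 %| m)%N) s ->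
  fps_ge0 (g * \prod_(m <- s) (1 - x ^+ m) / denom M).
Proof.
move=> g0 us /allP sP.
have sub : {subset s <= regular_parts M} by move=> m /sP /andP[]; exact: mem_regular_parts.
have /count_subseqP[s' ss' ps'] := leq_uniq_count us sub.
have [t pt] := perm_to_subseq ss'.
have unitP (r : seq nat) : {subset r <= regular_parts M} ->
    forall m, m \in r -> 1 - x ^+ m \is a GRing.unit.
  by move=> rP m /rP /regular_parts_gt0; exact: one_subx_unit.
have sU : \prod_(m <- s) (1 - x ^+ m) \is a GRing.unit.
  by apply: unitr_prod_in => m ms _; apply: (unitP s).
have tP : {subset t <= regular_parts M} by move=> m mt; rewrite (perm_mem pt) mem_cat mt orbT.
have tU : \prod_(m <- t) (1 - x ^+ m) \is a GRing.unit.
  by apply: unitr_prod_in => m mt _; apply: (unitP t).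
rewrite denomE (perm_big _ pt) big_cat -(perm_big _ ps') /=.
rewrite invrM // -mulrA [X in _ * X]mulrCA mulrV // mulr1.
apply: fps_ge0M => //; rewrite big_seq -prodrV => [|m /(unitP _ tP) //].
apply: fps_ge0_prod => m /tP /regular_parts_gt0 m0.
by rewrite -exprM; apply: fps_ge0_geometric; rewrite muln_gt0 S0.
Qed.

Lemma denom_unit M : denom M \is a GRing.unit.
Proof.
by rewrite denomE unitr_prod_in // => m /regular_parts_gt0 m0 _; apply: one_subx_unit.
Qed.

(** The bound 1 < J keeps the exponents 1 and J distinct when 3 divides 2J + 1,
    where both index factors to be cancelled. *)
Lemma pair_excess_ge0 M J : (1 < J < M)%N -> fps_ge0 (pair_excess x J / denom M).
Proof.
move=> /andP[J1 JM]; rewrite /pair_excess mulrDl; apply: fps_ge0D.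
  have [d3|n3] := boolP (3 %| (2 * J).+1)%N.
    (* 2J + 1 is odd and at least 5; both 2 and 5 are prime to 3. *)
    have -> : (2 * J).+1 = (2 * (J - 2) + 5)%N by lia.
    rewrite one_subX_split mulrDl; apply: fps_ge0D; apply: fps_ge0_cancel => //=; try lia.
      by apply: fps_ge0_sum => i _; apply: fps_ge0_xn.
    exact: fps_ge0_xn.
  have -> : (1 - x) * (1 - x ^+ (2 * J).+1)
      = 1 * \prod_(m <- [:: 1; (2 * J).+1]%N) (1 - x ^+ m).
    by rewrite !big_cons big_nil mul1r mulr1.
  by apply: fps_ge0_cancel; rewrite ?fps_ge0_1 //= ?inE ?n3; lia.
rewrite -(mulrA x); apply: fps_ge0M; first exact: fps_ge0_Xn.
have [d3|n3] := boolP (3 %| (2 * J).+1)%N.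
  (* Here J = 1 mod 3, so J is prime to 3 and 2J + 1 is traded for 1. *)
  rewrite [X in X * _ / _]mulrC [X in X / _]one_subX_prod3.
  apply: fps_ge0_cancel; rewrite /= ?inE; try lia.
  by apply: fps_ge0_sum => i _; apply: fps_ge0_xn.
(* Here 2J + 1 is prime to 3 and J is traded for 1. *)
rewrite [X in X / _]one_subX_prod3; apply: fps_ge0_cancel; rewrite /= ?inE; try lia.
by apply: fps_ge0_sum => i _; apply: fps_ge0_xn.
Qed.

Lemma boundary_ge0 M k : (0 < M)%N -> fps_ge0 (boundary x k / denom M).
Proof.
move=> M0; rewrite /boundary -mulrA; apply: fps_ge0M; first exact: fps_ge0_xn.
have -> : 1 - x ^+ k.-1 = (\sum_(i < k.-1) x ^+ i) * \prod_(m <- [:: 1%N]) (1 - x ^+ m).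
  by rewrite -one_subX_prod big_nil mulr1.
apply: fps_ge0_cancel => //=; last by lia.
by apply: fps_ge0_sum => i _; apply: fps_ge0_xn.
Qed.

Lemma denom_cvg n : exists N, forall M, (N <= M)%N ->
  fps_eq_upto n (denom M) (qpoch2 x (x ^+ 2) (x ^+ 3)).
Proof.
have [N1 h1] := fps_cvg_upto n (fpsX_qpoch_cvg int S (p := S * 3) ltac:(lia)).
have [N2 h2] := fps_cvg_upto n (fpsX_qpoch_cvg int (S * 2) (p := S * 3) ltac:(lia)).
exists (maxn N1 N2) => M; rewrite geq_max => /andP[/h1 {}h1 /h2 {}h2].
by rewrite !exprM in h1 h2; apply: fps_eq_uptoM.
Qed.

End Cubic.

Unset Implicit Arguments.

Theorem theorem1p7 (S k R : nat) (hS : (1 <= S)%N) (hk : (1 <= k)%N)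
    (hR : R = (3 * S)%N) (n : nat) :
  0 <= fpscoef
    ((-1) ^+ k *
     (fps_series k (theta_term R S)
      / qpoch2 (fpsX int ^+ S) (fpsX int ^+ (R - S)) (fpsX int ^+ R))) n.
Proof.
subst R.
have DU := @denominator_unit (3 * S) S ltac:(lia).
have [N1 hN] := fps_cvg_upto n (@numerator_cvg (3 * S) S k ltac:(lia)).
have [N2 hD] := denom_cvg hS n.
(* N pairs reach beyond q^n, and M exceeds every J that occurs in them. *)
pose N := maxn N1 n; pose M := maxn N2 (k + 2 * N).+3.
have {hN} := hN (k + 2 * N)%N ltac:(lia); have {hD} := hD M ltac:(lia).
have e1 : (fpsX int ^+ S) ^+ 2 = fpsX int ^+ (3 * S - S) by rewrite -exprM; congr (_ ^+ _); lia.
have e2 : (fpsX int ^+ S) ^+ 3 = fpsX int ^+ (3 * S) by rewrite -exprM mulnC.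
rewrite e1 e2 => /(fps_eq_uptoV (denom_unit hS M) DU) hD hN.
have -> := fps_eq_uptoM (fun m _ => erefl : fpscoef ((-1) ^+ k) m = _)
  (fps_eq_uptoM (fun m h => esym (hN m h)) (fun m h => esym (hD m h))) (leqnn n).
rewrite mulrA.
have -> : (-1) ^+ k * (\sum_(k <= j < k + 2 * N) theta_term (3 * S) S j)
  = \sum_(i < 2 * N) (-1) ^+ i * theta_pent (fpsX int ^+ S) (k + i).
  rewrite -{2}[k]add0n big_addn addKn big_mkord mulr_sumr.
  apply: eq_bigr => i _; rewrite addnC (theta_term_pent hS) mulrA -exprD addnA exprD addnn.
  by rewrite -mul2n exprM sqrrN !expr1n mul1r.
rewrite theta_pent_sum // mulrDl mulrBl !fpscoefD fpscoefN.
rewrite [X in _ - X + _](_ : _ = 0) ?subr0 ?addr_ge0 //.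
- by apply: boundary_ge0; lia.
- rewrite mulr_suml; apply: fps_ge0_sum => i _; rewrite -mulrA.
  by apply: fps_ge0M; [apply: fps_ge0_xn | apply: pair_excess_ge0 => //; have := ltn_ord i; lia].
(* The last boundary term starts beyond q^n. *)
rewrite /boundary -exprM -mulrA mulrC fpscoef_mulXn //.
by have := leq_pent (k + 2 * N); nia.
Qed.
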